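(* Let $\mathcal{H}=\mathcal{K}_1\oplus\mathcal{K}_2$ be a separable Hilbert space, where $\mathcal{K}_1,\mathcal{K}_2$ are Hilbert spaces with $0<\dim(\mathcal{K}_1)<\infty$ and $\dim(\mathcal{K}_2)=\infty$. Let $N=\mathcal{B}(\mathcal{K}_1)\oplus\mathcal{B}(\mathcal{K}_2)\subseteq\mathcal{B}(\mathcal{H})$ (the block-diagonal operators) and let $\mathbb{E}_N(x)=p_1xp_1+p_2xp_2$, where $p_i$ is the orthogonal projection of $\mathcal{H}$ onto $\mathcal{K}_i$. Then the triple $(\mathcal{B}(\mathcal{H}),N,\mathbb{E}_N)$ does not have the relative Haagerup property.
   Context: For a faithful normal positive functional $\varphi$ on a von Neumann algebra $M$, $L^2(M,\varphi)$ is the GNS Hilbert space with cyclic vector $\Omega_\varphi$, and $M\subseteq \mathcal{B}(L^2(M,\varphi))$. A linear map $\Phi:M\to M$ has an $L^2$-implementation $\Phi^{(2)}$ with respect to $\varphi$ if $x\Omega_\varphi\mapsto\Phi(x)\Omega_\varphi$ extends to a bounded operator $\Phi^{(2)}$ on $L^2(M,\varphi)$. Let $N\subseteq M$ be a unital inclusion and let $\varphi$ be a faithful normal positive functional on $M$ whose modular group satisfies $\sigma_t^\varphi(N)\subseteq N$ for all $t\in\mathbb{R}$; equivalently there is a (unique) $\varphi$-preserving faithful normal conditional expectation $\mathbb{E}_N:M\to N$. Let $e_N=\mathbb{E}_N^{(2)}$ be the orthogonal projection of $L^2(M,\varphi)$ onto the closure of $N\Omega_\varphi$, let $\mathcal{K}_{00}(M,N,\varphi)=\mathrm{Span}\{xe_Ny: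 x,y\in M\}$, and let $\mathcal{K}(M,N,\varphi)$ be its operator-norm closure. The triple $(M,N,\varphi)$ has the relative Haagerup property (rHAP) if there is a net $(\Phi_i)_{i\in I}$ of normal maps $\Phi_i:M\to M$ such that: (1) each $\Phi_i$ is completely positive and $\sup_i\|\Phi_i\|<\infty$; (2) each $\Phi_i$ is an $N$-$N$-bimodule map; (3) $\Phi_i(x)\to x$ strongly for every $x\in M$; (4) $\varphi\circ\Phi_i\le\varphi$ for all $i$; (5) $\Phi_i^{(2)}\in\mathcal{K}(M,N,\varphi)$ for all $i$. For a faithful normal conditional expectation $\mathbb{E}_N:M\to N$, the triple $(M,N,\mathbb{E}_N)$ has the relative Haagerup property if $(M,N,\varphi)$ has it for some (equivalently, any) faithful normal positive functional $\varphi$ on $M$ with $\varphi\circ\mathbb{E}_N=\varphi$. *)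

(* Defs.v *)
From HB Require Import structures.
From mathcomp Require Import all_boot all_order all_algebra.
From mathcomp Require Import sesquilinear complex.
From mathcomp Require Import all_classical all_reals all_analysis.

Set Implicit Arguments.
Unset Strict Implicit.
Unset Printing Implicit Defensive.

Import Order.TTheory GRing.Theory Num.Theory numFieldNormedType.Exports.
Local Open Scope classical_set_scope.
Local Open Scope complex_scope.
Local Open Scope ring_scope.

(* [inner u v] is linear in [u] and conjugate-linear in [v]. *)
Structure hilbertType (R : realType) := HilbertType {
  hilbert_space :> completeNormedModType R[i];
  inner : {dot hilbert_space for (@Num.conj R[i])};
  inner_norm : forall v : hilbert_space, inner v v = `|v| ^+ 2 }.

Arguments inner {R h}.

Definition separable (T : topologicalType) : Prop :=
  exists D : set T, countable D /\ dense D.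

Section Span.
Variables (K : nzRingType) (V : lmodType K).

Definition span (A : set V) : set V :=
  [set v | exists (n : nat) (c : 'I_n -> K) (s : 'I_n -> V),
     (forall i, A (s i)) /\ v = \sum_(i < n) c i *: s i].

Definition subspace (A : set V) : Prop :=
  A 0 /\ forall (a : K) (u v : V), A u -> A v -> A (a *: u + v).

Definition finite_dim (A : set V) : Prop :=
  exists B : set V, finite_set B /\ A = span B.

End Span.

(* Operators on H are plain functions, added and scaled pointwise and composed
   with [\o]; operator algebras are sets of such functions. *)
Section Operators.
Variables (R : realType) (H : hilbertType R).
Implicit Types (x y : H -> H) (K : set H) (M D : set (H -> H)).

(* the operator norm of x is at most c *)
Definition opnorm_le x (c : R[i]) : Prop := forall v : H, `|x v| <= c * `|v|.

Definition bounded_op x : Prop := linear x /\ exists c : R[i], opnorm_le x c.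

Definition bounded_ops : set (H -> H) := [set x | bounded_op x].

Definition is_adjoint x y : Prop :=
  forall v w : H, inner (x v) w = inner v (y w).

Definition selfadjoint x : Prop := is_adjoint x x.

(* In the order of R[i], [0 <= z] says that z is real and nonnegative. *)
Definition positive_op x : Prop := forall v : H, 0 <= inner (x v) v.

Definition op_le x y : Prop := positive_op (y - x).

(* Positivity of an operator matrix acting on the n-fold Hilbert sum of H. *)
Definition positive_opmx (n : nat) (X : 'I_n -> 'I_n -> (H -> H)) : Prop :=
  forall v : 'I_n -> H, 0 <= \sum_(i < n) \sum_(j < n) inner (X i j (v j)) (v i).

(* The vector of K nearest to v; a junk value if there is none, which does not
   happen for a closed subspace K. *)
Definition orthproj K (v : H) : H :=
  xget 0 [set w | K w /\ forall u, K u -> inner (v - w) u = 0].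

(* H is the internal Hilbert direct sum of K1 and K2. *)
Definition orthogonal_sum (K1 K2 : set H) : Prop :=
  [/\ subspace K1 /\ closed K1,
      subspace K2 /\ closed K2,
      forall u v, K1 u -> K2 v -> inner u v = 0 &
      forall w, exists u v, [/\ K1 u, K2 v & w = u + v]].

(* B(K1) (+) B(K2) inside B(H) *)
Definition block_diagonal (K1 K2 : set H) : set (H -> H) :=
  [set x | [/\ bounded_op x,
               forall v, K1 v -> K1 (x v) &
               forall v, K2 v -> K2 (x v)]].

Definition block_expectation (K1 K2 : set H) x : H -> H :=
  (orthproj K1 \o x \o orthproj K1) + (orthproj K2 \o x \o orthproj K2).

(* A nonempty upward directed set of self-adjoint elements of M. *)
Definition sa_directed M D : Prop :=
  [/\ D !=set0,
      forall x, D x -> M x /\ selfadjoint x &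
      forall x y, D x -> D y -> exists z, [/\ D z, op_le x z & op_le y z]].

(* s is the least upper bound of D in M *)
Definition op_sup M D (s : H -> H) : Prop :=
  [/\ M s, forall x, D x -> op_le x s &
      forall t, M t -> (forall x, D x -> op_le x t) -> op_le s t].

Definition linear_on (V : lmodType R[i]) M (f : (H -> H) -> V) : Prop :=
  forall (a : R[i]) x y, M x -> M y -> f (a *: x + y) = a *: f x + f y.

Definition faithful_normal_positive M (phi : (H -> H) -> R[i]) : Prop :=
  [/\ @linear_on R[i]^o M phi,
      forall x, M x -> positive_op x -> 0 <= phi x,
      forall x, M x -> positive_op x -> phi x = 0 -> x = 0 &
      forall D s, sa_directed M D -> op_sup M D s ->
        supremums (phi @` D) (phi s)].

(* Normality as preservation of suprema of bounded increasing nets, the usual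
   form of the notion for positive maps (all maps considered are). *)
Definition normal_map M (Phi : (H -> H) -> (H -> H)) : Prop :=
  forall D s, sa_directed M D -> op_sup M D s -> op_sup M (Phi @` D) (Phi s).

Definition completely_positive M (Phi : (H -> H) -> (H -> H)) : Prop :=
  forall (n : nat) (X : 'I_n -> 'I_n -> (H -> H)),
    (forall i j, M (X i j)) -> positive_opmx X ->
    positive_opmx (fun i j => Phi (X i j)).

(* the norm of Phi as a map from M to M is at most c *)
Definition mapnorm_le M (Phi : (H -> H) -> (H -> H)) (c : R[i]) : Prop :=
  forall x (d : R[i]), M x -> 0 <= d -> opnorm_le x d ->
    opnorm_le (Phi x) (c * d).

Definition bimodule_map M N (Phi : (H -> H) -> (H -> H)) : Prop :=
  forall a x b, N a -> M x -> N b -> Phi (a \o x \o b) = a \o Phi x \o b.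

End Operators.

Section RelativeHaagerup.
Variables (R : realType) (H : hilbertType R).

(* L^2(M, phi), determined up to a unitary intertwining the representations
   and the cyclic vectors. *)
Record gns (M : set (H -> H)) (phi : (H -> H) -> R[i]) := Gns {
  gns_space :> hilbertType R;
  gns_rep : (H -> H) -> (gns_space -> gns_space);
  gns_vec : gns_space;
  gns_bounded : forall x, M x -> bounded_op (gns_rep x);
  gns_linear : linear_on M gns_rep;
  gns_mul : forall x y, M x -> M y -> gns_rep (x \o y) = gns_rep x \o gns_rep y;
  gns_one : gns_rep id = id;
  gns_adjoint : forall x y, M x -> M y -> is_adjoint x y ->
    is_adjoint (gns_rep x) (gns_rep y);
  gns_state : forall x, M x -> inner (gns_rep x gns_vec) gns_vec = phi x;
  gns_cyclic : dense [set gns_rep x gns_vec | x in M] }.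

Arguments gns_rep {M phi} g x.
Arguments gns_vec {M phi} g.

Section Fixed.
Variables (M N : set (H -> H)) (phi : (H -> H) -> R[i]) (G : gns M phi).

(* T is the L^2-implementation of Phi *)
Definition l2_implementation (Phi : (H -> H) -> (H -> H)) (T : G -> G) : Prop :=
  bounded_op T /\
  forall x, M x -> T (gns_rep G x (gns_vec G)) = gns_rep G (Phi x) (gns_vec G).

Definition jones_projection : G -> G :=
  orthproj (closure [set gns_rep G x (gns_vec G) | x in N]).

Definition K00 : set (G -> G) :=
  span [set gns_rep G xy.1 \o jones_projection \o gns_rep G xy.2
       | xy in M `*` M].

Definition rel_compact : set (G -> G) :=
  [set T | bounded_op T /\
     forall e : R[i], 0 < e -> exists S, K00 S /\ opnorm_le (T - S) e].

End Fixed.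

Definition directed (I : Type) (le : I -> I -> Prop) : Prop :=
  [/\ inhabited I, forall i, le i i,
      forall i j k, le i j -> le j k -> le i k &
      forall i j, exists k, le i k /\ le j k].

Definition tails (I : Type) (le : I -> I -> Prop) : set_system I :=
  [set A | exists i0, forall i, le i0 i -> A i].

(* For N inside M von Neumann algebras on H, and phi a faithful normal positive
   functional on M preserved by a faithful normal conditional expectation of M
   onto N. Strong convergence is that of B(L^2(M, phi)). *)
Definition rHAP_functional (M N : set (H -> H)) (phi : (H -> H) -> R[i]) : Prop :=
  exists (G : gns M phi) (I : Type) (le : I -> I -> Prop)
         (Phi : I -> (H -> H) -> (H -> H)),
    directed le /\
    (forall i, [/\ forall x, M x -> M (Phi i x), linear_on M (Phi i) &
                   normal_map M (Phi i)]) /\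
    [/\ (forall i, completely_positive M (Phi i)) /\
        (exists c : R[i], forall i, mapnorm_le M (Phi i) c),
        forall i, bimodule_map M N (Phi i),
        forall x, M x -> forall xi : G,
          gns_rep G (Phi i x) xi @[i --> tails le] --> gns_rep G x xi,
        forall i x, M x -> positive_op x -> phi (Phi i x) <= phi x &
        forall i, exists T : G -> G,
          l2_implementation (Phi i) T /\ rel_compact N T].

(* For E a faithful normal conditional expectation of M onto N. *)
Definition rHAP (M N : set (H -> H)) (E : (H -> H) -> (H -> H)) : Prop :=
  exists phi : (H -> H) -> R[i],
    [/\ faithful_normal_positive M phi,
        forall x, M x -> phi (E x) = phi x &
        rHAP_functional M N phi].

End RelativeHaagerup.

(* Main.v *)
Require Import Defs.
From mathcomp Require Import all_boot all_order all_algebra.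
From mathcomp Require Import sesquilinear complex.
From mathcomp Require Import ring.
From mathcomp Require Import all_classical all_reals all_analysis.

(* A bimodule map over N acts as a scalar c on the corner p2 B(H) p1, by
   Schur's lemma. For unit vectors u in K1, fixed, and w in K2, the vectors
   |w><u| Omega are eigenvectors of Phi^(2) for c. On the other hand
   e_N y |w><u| Omega = |p1 y w><u| Omega, which vanishes when p1 y w = 0, and
   for finitely many y such a w exists because K1 is finite-dimensional and K2
   is not. So every element of K00 kills some |w><u| Omega, an approximation of
   Phi^(2) by K00 forces c = 0, and maps Phi with c = 0 cannot converge to the
   identity. *)

Set Implicit Arguments.
Unset Strict Implicit.
Unset Printing Implicit Defensive.

Import Order.TTheory GRing.Theory Num.Theory numFieldNormedType.Exports.
Local Open Scope classical_set_scope.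
Local Open Scope complex_scope.
Local Open Scope ring_scope.

(** * Inner products and orthogonal projections *)

Section InnerProduct.
Variables (R : realType) (H : hilbertType R).
Implicit Types (u v w : H) (K : set H).

Lemma innerC u v : inner u v = Num.conj (inner v u).
Proof. by rewrite hermC /= expr0 mul1r. Qed.

Lemma innerDl u v w : inner (u + v) w = inner u w + inner v w.
Proof. exact: linearDl. Qed.

Lemma innerBl u v w : inner (u - v) w = inner u w - inner v w.
Proof. exact: linearBl. Qed.

Lemma innerBr u v w : inner u (v - w) = inner u v - inner u w.
Proof. exact: linearBr. Qed.

Lemma inner0l u : inner 0 u = 0.
Proof. exact: linear0l. Qed.

Lemma innerZl (a : R[i]) u v : inner (a *: u) v = a * inner u v.
Proof. exact: linearZl_LR. Qed.

Lemma innerZr (a : R[i]) u v : inner u (a *: v) = Num.conj a * inner u v.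
Proof. exact: linearZr_LR. Qed.

Lemma inner_eq0C u v : inner u v = 0 -> inner v u = 0.
Proof. by move=> uv0; rewrite innerC uv0 conjC0. Qed.

Lemma inner_self_eq0 v : inner v v = 0 -> v = 0.
Proof. by rewrite inner_norm => /eqP; rewrite expf_eq0 /= normr_eq0 => /eqP. Qed.

Lemma inner_self_neq0 v : v != 0 -> inner v v != 0.
Proof. by apply: contra_neq => /inner_self_eq0. Qed.

Lemma cauchy_schwarz u v : `|inner u v| <= `|u| * `|v|.
Proof.
have [->|v0] := eqVneq v 0; first by rewrite innerC inner0l conjC0 !normr0 mulr0.
have nv0 : 0 < `|v| by rewrite normr_gt0.
have vv0 := inner_self_neq0 v0.
set a := inner u v / inner v v.
have wv : inner (u - a *: v) v = 0 by rewrite innerBl innerZl divfK ?subrr.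
have : 0 <= inner (u - a *: v) (u - a *: v) by rewrite inner_norm exprn_ge0.
rewrite innerBr innerZr wv mulr0 subr0 innerBl innerZl (innerC v u) /a mulrAC.
rewrite -normCK 2!inner_norm subr_ge0 ler_pdivrMr ?exprn_gt0 // -exprMn.
by rewrite ler_sqr // nnegrE ?mulr_ge0.
Qed.

(** Continuity of the inner product, by Cauchy-Schwarz: <v, u> = <v, u - w> for every [w] in [A],
    and [w] can be taken close to [u]. *)
Lemma closure_orthogonal (A : set H) v :
  (forall u, A u -> inner v u = 0) -> forall u, closure A u -> inner v u = 0.
Proof.
move=> vA u Au; apply/eqP/negPn/negP => vu0.
have nvu : 0 < `|inner v u| by rewrite normr_gt0.
(* Adding 1 makes the divisor positive without a case distinction on [v]. *)
have e0 : 0 < `|inner v u| / (`|v| + 1) by rewrite divr_gt0 ?ltr_wpDl.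
have [w [Aw]] := Au _ (nbhsx_ballx u _ e0).
rewrite -ball_normE /= ltr_pdivlMr ?ltr_wpDl // => uw.
have le_vu : `|inner v u| <= `|v| * `|u - w|.
  by rewrite -[inner v u]subr0 -(vA w Aw) -innerBr cauchy_schwarz.
have lt_vu : `|v| * `|u - w| < `|inner v u|.
  by apply: le_lt_trans uw; rewrite mulrC ler_wpM2l // lerDl.
by have := le_lt_trans le_vu lt_vu; rewrite ltxx.
Qed.

(** The vector 0 meets the condition that [xget] selects by, and any candidate [w] is orthogonal to
    itself. *)
Lemma orthproj_orthogonal K v :
  K 0 -> (forall u, K u -> inner v u = 0) -> orthproj K v = 0.
Proof.
move=> K0 vK; apply: xget_unique => [|w [Kw /(_ w Kw)]].
  by split=> // u Ku; rewrite subr0 vK.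
by rewrite innerBl vK // sub0r => /eqP; rewrite oppr_eq0 => /eqP/inner_self_eq0.
Qed.

End InnerProduct.

(** * Finitely many linear forms on an infinite-dimensional subspace *)

Section Span.
Variables (K : fieldType) (V : lmodType K).

(** If [w] in [A] has [f w != 0], every [v] in [A] is [(f v / f w) *: w] plus an element of the
    kernel, so adding [w] to a spanning set of the kernel gives one of [A]. *)
Lemma finite_dim_kernel (A : set V) (f : V -> K) :
  Defs.subspace A -> (forall a u v, f (a *: u + v) = a * f u + f v) ->
  finite_dim (A `&` [set v | f v = 0]) -> finite_dim A.
Proof.
move=> [A0 Alin] flin [B [finB AB]].
have [[w Aw fw]|nw] := pselect (exists2 w, A w & f w != 0); last first.
  exists B; split=> //; rewrite -AB; apply/seteqP; split=> [v Av|v [] //].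
  by split=> //; apply/eqP/negPn/negP => fv; apply: nw; exists v.
exists (w |` B); split; first by rewrite finite_setU; split.
have BA v : B v -> A v.
  move=> Bv; suff [] : (A `&` [set v | f v = 0]) v by [].
  rewrite AB; exists 1%N, (fun=> 1), (fun=> v); split=> //.
  by rewrite big_ord1 scale1r.
apply/seteqP; split=> [v Av|v [n [c [s [Bs ->]]]]]; last first.
  elim/big_ind: _ => // [x y Ax Ay|i _]; first by rewrite -[x]scale1r; apply: Alin.
  rewrite -[_ *: _]addr0; apply: Alin => //.
  by case: (Bs i) => [->//|/BA].
have : (A `&` [set v | f v = 0]) (- (f v / f w) *: w + v).
  by split; [exact: Alin|rewrite /= flin mulNr divfK // addNr].
rewrite AB => -[n [c [s [Bs e]]]].
(* Index 0 carries [w]; the others carry the expansion of the kernel element, shifted by one. *)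
exists n.+1, (fun i => if unlift ord0 i is Some j then c j else f v / f w).
exists (fun i => if unlift ord0 i is Some j then s j else w); split.
  by move=> i; case: unliftP => [j _|_]; [right|left].
rewrite big_ord_recl unlift_none.
under eq_bigr do rewrite liftK.
by rewrite -e scaleNr addrA subrr add0r.
Qed.

(** Induction on [n]: by [finite_dim_kernel], the kernel of the first form in [A] is still
    infinite-dimensional. For [n = 0], a subspace without nonzero vectors would be the span of the
    empty set. *)
Lemma common_kernel (A : set V) (n : nat) (f : 'I_n -> V -> K) :
  Defs.subspace A -> (forall i a u v, f i (a *: u + v) = a * f i u + f i v) ->
  ~ finite_dim A -> exists v, [/\ A v, v != 0 & forall i, f i v = 0].
Proof.
elim: n A f => [|n IH] A f sA flin infA.
  apply: contrapT => nv; apply: infA; exists set0; split=> //.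
  apply/seteqP; split=> [v Av|_ [[|n] [c [s [Bs ->]]]]].
  - exists 0%N, (fun=> 0), (fun=> 0); split; first by case.
    rewrite big_ord0; apply/eqP/negPn/negP => v0; apply: nv.
    by exists v; split=> //; case.
  - by rewrite big_ord0; case: sA.
  - by case: (Bs ord0).
have f0 i : f i 0 = 0.
  by have := flin i (-1) 0 0; rewrite scaler0 addr0 mulN1r addNr.
have [||v [[Av v0] nv fv]] := IH (A `&` [set v | f ord0 v = 0])
    (fun i => f (lift ord0 i)) _ (fun i => flin _).
- case: sA => A0 Alin; split; first by split=> //; exact: f0.
  move=> a u v [Au fu] [Av fv]; split; first exact: Alin.
  by rewrite /= flin fu fv mulr0 addr0.
- by move/finite_dim_kernel; auto.
by exists v; split=> // i; case: (unliftP ord0 i) => [j ->|->].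
Qed.

End Span.

(** * Rank-one operators and bounded operators *)

Section RankOne.
Variables (R : realType) (H : hilbertType R).
Implicit Types (u v w : H) (x y : H -> H).

(** The operator |w><u| of bra-ket notation. *)
Definition rank_one w u : H -> H := fun v => inner v u *: w.

Lemma rank_one_bounded w u : bounded_op (rank_one w u).
Proof.
split=> [a v v'|]; first by rewrite /rank_one innerDl innerZl scalerDl scalerA.
exists (`|u| * `|w|) => v; rewrite normrZ mulrAC ler_wpM2r // mulrC.
exact: cauchy_schwarz.
Qed.

Lemma rank_one_adjoint w u : is_adjoint (rank_one w u) (rank_one u w).
Proof. by move=> v z; rewrite innerZl innerZr -innerC mulrC. Qed.

Lemma bounded_op0 x : bounded_op x -> x 0 = 0.
Proof.
case=> xlin _; have := xlin (-1) 0 0.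
by rewrite scaler0 addr0 scaleN1r addNr.
Qed.

Lemma bounded_opZ x (a : R[i]) v : bounded_op x -> x (a *: v) = a *: x v.
Proof.
by move=> bx; case: (bx) => xlin _; have := xlin a v 0; rewrite (bounded_op0 bx) !addr0.
Qed.

Lemma bounded_op_comp x y : bounded_op x -> bounded_op y -> bounded_op (x \o y).
Proof.
move=> [xlin [c xc]] [ylin [d yd]]; split=> [a u v|].
  by rewrite /= ylin xlin.
(* On the zero space [opnorm_le] does not force [c] to be nonnegative, hence the absolute value; a
   nonzero [y v] does force it. *)
exists (`|c| * d) => v /=.
have cc : c * `|y v| <= `|c| * `|y v|.
  have [->|yv0] := eqVneq (y v) 0; first by rewrite normr0 !mulr0.
  have yv : 0 < `|y v| by rewrite normr_gt0.
  have c0 : 0 <= c by rewrite -(pmulr_lge0 _ yv) (le_trans _ (xc _)).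
  by rewrite ger0_norm.
by apply: le_trans (xc _) (le_trans cc _); rewrite -mulrA ler_wpM2l.
Qed.

Lemma bounded_op_rank_one x w u : bounded_op x ->
  x \o rank_one w u = rank_one (x w) u.
Proof. by move=> bx; apply/funext => v; rewrite /rank_one /= bounded_opZ. Qed.

End RankOne.

Lemma bounded_op_zero (R : realType) (H : hilbertType R) :
  bounded_op (0 : H -> H).
Proof.
split=> [a u v|]; first by rewrite scaler0 addr0.
by exists 0 => v; rewrite normr0 mul0r.
Qed.

Lemma linear_on0 (R : realType) (H : hilbertType R) (V : lmodType R[i])
  (M : set (H -> H)) (f : (H -> H) -> V) : linear_on M f -> M 0 -> f 0 = 0.
Proof.
by move=> flin M0; have := flin (-1) _ _ M0 M0; rewrite scaler0 addr0 scaleN1r addNr.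
Qed.

(** * Projections and block-diagonal operators of an orthogonal sum *)

Section OrthogonalSum.
Variables (R : realType) (H : hilbertType R) (K1 K2 : set H).
Hypothesis H_sum : orthogonal_sum K1 K2.

Lemma orthogonal_sum_sym : orthogonal_sum K2 K1.
Proof.
case: H_sum => s1 s2 o12 dec; split=> // [u v Ku Kv|w].
  exact/inner_eq0C/o12.
by have [u [v [Ku Kv ->]]] := dec w; exists v, u; split=> //; rewrite addrC.
Qed.

(** The [K1]-component of [v] meets the condition in [orthproj], so [xget] does not return its
    default value. *)
Lemma orthproj_in v : K1 (orthproj K1 v).
Proof.
case: H_sum => _ _ o12 dec; have [u [w [Ku Kw vE]]] := dec v.
set P := [set z | K1 z /\ forall t, K1 t -> inner (v - z) t = 0].
suff /(xgetPex 0)[] : exists z, P z by [].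
exists u; split=> // t Kt; rewrite vE addrC addKr.
exact/inner_eq0C/o12.
Qed.

(** The [K1]-component of [v] is orthogonal to itself, hence zero. *)
Lemma orthogonal_complement v : (forall u, K1 u -> inner v u = 0) -> K2 v.
Proof.
case: H_sum => _ _ o12 dec; have [u [w [Ku Kw ->]]] := dec v.
move=> /(_ u Ku); rewrite innerDl (inner_eq0C (o12 _ _ Ku Kw)) addr0.
by move=> /inner_self_eq0 ->; rewrite add0r.
Qed.

Lemma orthogonal_sumZ (a : R[i]) u : K1 u -> K1 (a *: u).
Proof.
by case: H_sum => -[[K10 lin1] _] _ _ _ Ku; rewrite -[_ *: _]addr0; exact: lin1.
Qed.

Lemma rank_one_block_diagonal w u : K1 w -> K1 u ->
  block_diagonal K1 K2 (rank_one w u).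
Proof.
case: (H_sum) => _ [[K20 _] _] o12 _ Kw Ku.
split=> [|v Kv|v Kv]; first exact: rank_one_bounded.
  exact: orthogonal_sumZ.
by rewrite /rank_one (inner_eq0C (o12 _ _ Ku Kv)) scale0r.
Qed.

End OrthogonalSum.

Lemma block_diagonal_sym (R : realType) (H : hilbertType R) (K1 K2 : set H) :
  block_diagonal K1 K2 = block_diagonal K2 K1.
Proof. by apply/seteqP; split=> x []. Qed.

Arguments gns_rep {R H M phi} g x.
Arguments gns_vec {R H M phi} g.

(** * The corner p2 B(H) p1 in the GNS space *)

Section OffDiagonal.
Variables (R : realType) (H : hilbertType R) (K1 K2 : set H).
Hypothesis H_sum : orthogonal_sum K1 K2.

(** Both compressions vanish: p1 x p1 because [x] kills [K1], and p2 x p2 because [x] sends [K2]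
    into [K1]. *)
Lemma block_expectation_offdiag (x : H -> H) : bounded_op x ->
  (forall v, K1 v -> x v = 0) -> (forall v, K2 v -> K1 (x v)) ->
  block_expectation K1 K2 x = 0.
Proof.
case: (H_sum) => -[[K10 _] _] [[K20 _] _] o12 _ bx x1 x2; apply/funext => v.
have p1 := orthproj_in H_sum v.
have p2 := orthproj_in (orthogonal_sum_sym H_sum) v.
change (orthproj K1 (x (orthproj K1 v)) + orthproj K2 (x (orthproj K2 v)) = 0).
rewrite x1 // (orthproj_orthogonal K10) => [|u _]; last exact: inner0l.
by rewrite add0r orthproj_orthogonal // => u Ku; exact: o12 (x2 _ p2) Ku.
Qed.

Variables (phi : (H -> H) -> R[i]) (G : gns (@bounded_ops R H) phi).
Hypothesis phi_linear :
  @linear_on R H R[i]^o (@bounded_ops R H) phi.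
Hypothesis phi_E :
  forall x, bounded_op x -> phi (block_expectation K1 K2 x) = phi x.

Let vec (x : H -> H) : G := gns_rep G x (gns_vec G).

(** The adjoint [z] of [y] is an argument because operators are plain functions; below, [y] is
    always of rank one and its adjoint is explicit. *)
Lemma gns_inner (x y z : H -> H) : bounded_op x -> bounded_op y -> bounded_op z ->
  is_adjoint z y -> inner (vec x) (vec y) = phi (z \o x).
Proof.
move=> bx by_ bz zy; rewrite -(gns_state G); last exact: bounded_op_comp.
rewrite gns_mul //=; exact/esym/gns_adjoint.
Qed.

(** The vector is orthogonal to N Omega: its inner product with x Omega, for [x] in N, is the value
    of [phi] at |u><w| x. This operator kills [K1] and sends [K2] into [K1], so its expectation is
    0, and [phi] is invariant under the expectation. *)
Lemma jones_projection_offdiag w u : K2 w -> K1 u ->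
  jones_projection (block_diagonal K1 K2) (vec (rank_one w u)) = 0.
Proof.
move=> Kw Ku; have [[[K10 _] _] [[K20 _] _] o12 _] := H_sum.
apply: orthproj_orthogonal.
  apply: subset_closure; exists 0; last first.
    by rewrite (linear_on0 (gns_linear G)) //; exact: bounded_op_zero.
  by split; first exact: bounded_op_zero.
apply: closure_orthogonal => _ [x [bx x1 x2] <-].
apply: inner_eq0C.
rewrite (gns_inner bx (rank_one_bounded _ _) (rank_one_bounded _ _)
  (rank_one_adjoint u w)).
have bz := bounded_op_comp (rank_one_bounded u w) bx.
rewrite -phi_E // block_expectation_offdiag //.
- exact: (linear_on0 phi_linear (bounded_op_zero H)).
- by move=> v Kv; rewrite /rank_one /= o12 ?scale0r //; exact: x1.
- by move=> v Kv; exact: (orthogonal_sumZ H_sum).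
Qed.

(* Schur's lemma for the irreducible B(K2)-B(K1)-bimodule B(K1, K2). *)
Lemma bimodule_map_offdiag (Phi : (H -> H) -> (H -> H)) u w0 :
  bimodule_map (@bounded_ops R H) (block_diagonal K1 K2) Phi ->
  bounded_op (Phi (rank_one w0 u)) ->
  K1 u -> K2 w0 -> u != 0 -> w0 != 0 ->
  exists c : R[i], forall w, K2 w ->
    Phi (rank_one w u) = c *: rank_one w u.
Proof.
move=> Phibi bPhi Ku Kw0 /inner_self_neq0 u0 /inner_self_neq0 w00.
(* Both [a w] and [b] lie in N, and |w><u| = a w |w0><u| b. Pulling them out of [Phi] leaves a
   multiple of |w><u| whose coefficient is a matrix entry of Phi(|w0><u|), independent of [w]. *)
pose a w := rank_one ((inner w0 w0)^-1 *: w) w0.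
pose b := rank_one ((inner u u)^-1 *: u) u.
exists (inner (Phi (rank_one w0 u) u) w0 / (inner w0 w0 * inner u u)) => w Kw.
have {1}-> : rank_one w u = a w \o rank_one w0 u \o b.
  apply/funext => v; rewrite /a /b /rank_one /= !innerZl !scalerA !mulrA.
  by rewrite divfK // mulfK.
have Nsym := block_diagonal_sym K1 K2.
rewrite Phibi; last first.
- exact: (rank_one_block_diagonal H_sum (orthogonal_sumZ H_sum _ Ku) Ku).
- exact: rank_one_bounded.
- rewrite Nsym; have sum' := orthogonal_sum_sym H_sum.
  exact: (rank_one_block_diagonal sum' (orthogonal_sumZ sum' _ Kw) Kw0).
apply/funext => v.
rewrite /= /b {2}/rank_one scalerA bounded_opZ // /a {1}/rank_one innerZl scalerA.
rewrite -[RHS]/(_ *: (_ *: w)) scalerA; congr (_ *: _).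
by field; rewrite u0.
Qed.

Hypothesis phi_faithful :
  forall x, bounded_op x -> positive_op x -> phi x = 0 -> x = 0.

(** The squared norm of the vector is [phi] of the positive operator |u><w| |w><u|, which is nonzero
    at [u]; faithfulness applies. *)
Lemma vec_rank_one_neq0 w u : w != 0 -> u != 0 -> vec (rank_one w u) != 0.
Proof.
move=> w0 u0; apply/eqP => x0.
have bx := rank_one_bounded w u; have by_ := rank_one_bounded u w.
have := gns_inner bx bx by_ (rank_one_adjoint u w).
rewrite x0 inner0l => /esym/(phi_faithful (bounded_op_comp by_ bx)) xx0.
have {xx0} : rank_one u w \o rank_one w u = 0.
  apply: xx0.
  by move=> v; rewrite /= (rank_one_adjoint u w) inner_norm exprn_ge0.
move/(congr1 (fun f => f u)); rewrite /rank_one /= innerZl => /eqP.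
by rewrite scaler_eq0 mulf_eq0 (negPf u0) !(negPf (inner_self_neq0 _)).
Qed.

Lemma vecZ (c : R[i]) x : bounded_op x -> vec (c *: x) = c *: vec x.
Proof.
move=> bx; have b0 := bounded_op_zero H; have := gns_linear G c bx b0.
by rewrite /vec (linear_on0 (gns_linear G)) // !addr0 => ->.
Qed.

(** Were [c] nonzero, some element of [K00] would be within [|c| / 2] of [T]. At a vector which that
    element kills, this gives [|c| <= |c| / 2]. *)
Lemma rel_compact_offdiag (T : G -> G) (u : H) (c : R[i]) :
  finite_dim K1 -> ~ finite_dim K2 -> K1 u -> u != 0 ->
  rel_compact (block_diagonal K1 K2) T ->
  (forall w, K2 w -> T (vec (rank_one w u)) = c *: vec (rank_one w u)) -> c = 0.
Proof.
move=> [B [/finite_seqP[s ->] K1B]] infK2 Ku u0 [_ Tcpt] Tvec.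
apply/eqP/negPn/negP => c0.
have e0 : 0 < `|c| / 2 by rewrite divr_gt0 ?normr_gt0.
have [_ [[n [a [S [SK ->]]]] TS]] := Tcpt _ e0.
have SE i : exists p : (H -> H) * (H -> H), [/\ bounded_op p.1, bounded_op p.2 &
    gns_rep G p.1 \o jones_projection (block_diagonal K1 K2) (G:=G)
      \o gns_rep G p.2 = S i].
  by have [p [? ?] ?] := SK i; exists p.
have [xy xyP] := choice SE.
(* One form for each pair of a right factor y of the [K00] element and a spanning vector of [K1]; if
   all vanish at [w], every y w is orthogonal to [K1]. *)
pose f (k : 'I_#|{: 'I_n * 'I_(size s)}|) v :=
  inner ((xy (enum_val k).1).2 v) (s`_(enum_val k).2).
have [|k b v v'|w [Kw w0 fw]] := @common_kernel _ _ K2 _ f _ _ infK2.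
- by case: H_sum => _ [].
- by rewrite /f; case: (xyP (enum_val k).1) => _ [-> _]; rewrite innerDl innerZl.
have K2y i : K2 ((xy i).2 w).
  apply: (orthogonal_complement H_sum) => v; rewrite K1B => -[m [d [t [ts ->]]]].
  apply: inner_eq0C; rewrite linear_sumlz big1 // => j _.
  have tj : (index (t j) s < size s)%N by rewrite index_mem; exact: ts.
  have := fw (enum_rank (i, Ordinal tj)).
  rewrite /f enum_rankK /= nth_index; last exact: ts.
  by move=> /inner_eq0C h; rewrite innerZl h mulr0.
have := TS (vec (rank_one w u)).
have -> : (T - \sum_(i < n) a i *: S i) (vec (rank_one w u)) =
    c *: vec (rank_one w u).
  rewrite -Tvec //; rewrite -[RHS]subr0; congr (_ - _).
  rewrite fct_sumE big1 // => i _; have [bx by_ <-] := xyP i.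
  (* Regrouping shows y |w><u| = |y w><u| applied to Omega; since y w lies in [K2], the Jones
     projection kills the result. *)
  rewrite -[LHS]/(a i *: gns_rep G (xy i).1 (jones_projection _
    ((gns_rep G (xy i).2 \o gns_rep G (rank_one w u)) (gns_vec G)))).
  rewrite -gns_mul ?bounded_op_rank_one //; last exact: rank_one_bounded.
  rewrite jones_projection_offdiag // bounded_op0 ?scaler0 //.
  exact: gns_bounded.
rewrite normrZ ler_pM2r ?normr_gt0; last exact: vec_rank_one_neq0.
rewrite ler_pdivlMr // ger_pMr ?normr_gt0 //.
by rewrite -subr_le0 addrK ler10.
Qed.

End OffDiagonal.

(** * The contradiction with strong convergence *)

Theorem theorem6p4 (R : realType) (H : hilbertType R) (K1 K2 : set H)
    (H_separable : separable H)
    (H_sum : orthogonal_sum K1 K2)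
    (K1_finite : finite_dim K1)
    (K1_nonzero : K1 <> [set 0])
    (K2_infinite : ~ finite_dim K2) :
  ~ rHAP (@bounded_ops R H) (block_diagonal K1 K2) (block_expectation K1 K2).
Proof.
case=> phi [[phi_linear _ phi_faithful _] phi_E].
case=> G [I [le [Phi [[_ le_refl _ _]]]]].
case=> Phi_M [_ Phi_bimodule Phi_cvg _ Phi_L2].
have [u Ku u0] : exists2 u, K1 u & u != 0.
  apply: contrapT => nu; apply: K1_nonzero; apply/seteqP; split=> [v Kv|_ ->].
    by apply/eqP/negPn/negP => v0; apply: nu; exists v.
  by case: H_sum => -[[]].
(* With zero forms, [common_kernel] just gives a nonzero vector of [K2]. *)
have [||w [Kw w0 _]] := @common_kernel _ _ K2 0 (fun _ _ => 0) _ _ K2_infinite.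
- by case: H_sum => _ [].
- by move=> _ a v v'; rewrite mulr0 addr0.
pose x := rank_one w u; have bx : bounded_op x := rank_one_bounded w u.
have vecx0 := vec_rank_one_neq0 G phi_faithful w0 u0.
have Phix0 i : Phi i x = 0.
  have [Phi_in _ _] := Phi_M i.
  have [c cE] :=
    bimodule_map_offdiag H_sum (Phi_bimodule i) (Phi_in _ bx) Ku Kw u0 w0.
  have [T [[_ TE] Tcpt]] := Phi_L2 i.
  suff c0 : c = 0 by rewrite cE // c0 scale0r.
  apply: (rel_compact_offdiag H_sum phi_linear phi_E phi_faithful K1_finite
    K2_infinite Ku u0 Tcpt) => v Kv.
  have bv := rank_one_bounded v u.
  by rewrite TE // cE // vecZ.
have e0 : 0 < `|gns_rep G x (gns_vec G)| by rewrite normr_gt0.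
(* An index lies in its own tail, so Phi_i(x) Omega = 0 would be in the open ball around x Omega
   whose radius is the norm of x Omega. *)
have [i /(_ i (le_refl i))] := Phi_cvg x bx (gns_vec G) _ (nbhsx_ballx _ _ e0).
rewrite -ball_normE /= Phix0 (linear_on0 (gns_linear G)); last exact: bounded_op_zero.
by rewrite subr0 ltxx.
Qed.
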